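(* Let $\mathbb{A}$ be an acyclic cluster algebra over $\mathbb{C}$ with trivial coefficients of even rank $n=2k$, given by a seed $(x_1,\ldots,x_n,B)$ where $B=(b_{ij})$ is an invertible skew-symmetric $n\times n$ integer matrix satisfying $b_{ij}>0$ whenever $i<j$. Write $B^{-1}=((b^{-1})_{ij})$ and suppose that for every $i\in[1,n]$ $$\sum_{j=1}^n (b^{-1})_{ij}\bigl(\max(b_{ij},0)+\min(b_{ij},0)\bigr)\neq 0 .$$ Then the Poisson cluster algebra $\mathbb{A}$ with Poisson structure defined by a compatible pair $(B,\Lambda)$, where $\Lambda=\mu B^{-1}$ with $0\ne\mu\in\mathbb{Z}$, contains no non-trivial Poisson prime ideals.
   Context: Cluster algebra. Let $\mathfrak{F}=\mathbb{C}(x_1,\ldots,x_n)$. For $1\le i\le n$ put $P_i=\prod_{k=1}^n x_k^{\max(b_{ik},0)}+\prod_{k=1}^n x_k^{-\min(b_{ik},0)}$ and $y_i=x_i^{-1}P_i$. Mutation of the seed $(x_1,\ldots,x_n,B)$ in direction $k$ replaces $x_k$ by $y_k$ and $B$ by $B'$ with $b'_{ij}=-b_{ij}$ if $i=k$ or $j=k$, and $b'_{ij}=b_{ij}+\frac{|b_{ik}|b_{kj}+b_{ik}|b_{kj}|}{2}$ otherwise. The cluster algebra $\mathbb{A}$ is the $\mathbb{C}$-subalgebra of $\mathfrak{F}$ generated by the elements of all clusters of seeds obtained by iterated mutation (all $n$ directions are mutable; ''trivial coefficients'' means there are no frozen variables). Compatible pair. $(B,\Lambda)$ with $\Lambda$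 an $n\times n$ integer matrix is a compatible pair if $B\Lambda$ is a diagonal matrix with positive integer diagonal entries. It defines the Poisson bracket on $\mathfrak{F}$ with $\{x_i,x_j\}=\lambda_{ij}x_ix_j$, where $\Lambda=(\lambda_{ij})$, which restricts to a Poisson bracket on $\mathbb{A}$. A Poisson prime ideal is a prime ideal $I$ of $\mathbb{A}$ with $\{h,a\}\in I$ for all $h\in I$, $a\in\mathbb{A}$; it is non-trivial if it is nonzero (and proper). *)

(* Defs.v *)
From HB Require Import structures.
From mathcomp Require Import all_boot all_order all_algebra.
From mathcomp Require Import fraction complex reals mpoly ring.

Set Implicit Arguments.
Unset Strict Implicit.
Unset Printing Implicit Defensive.

Import Order.TTheory GRing.Theory Num.Theory.
Local Open Scope ring_scope.
Local Open Scope quotient_scope.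

Notation ratfun K n := {fraction {mpoly K[n]}}.
Notation tofrac := (@FracField.tofrac _).

Section Seeds.
Variables (K : fieldType) (n : nat).
Local Notation F := (ratfun K n).

Definition ratcst (c : K) : F := tofrac c%:MP_[n].
Definition ratvar (i : 'I_n) : F := tofrac 'X_i.

Record seed := Seed { cluster : 'I_n -> F; exchange : 'M[int]_n }.

Definition initial_seed (B : 'M[int]_n) : seed := Seed ratvar B.

(* The division by 2 is exact: the numerator is 0 or +-2 b_ik b_kj. *)
Definition mutate_mx (k : 'I_n) (B : 'M[int]_n) : 'M[int]_n :=
  \matrix_(i, j) if (i == k) || (j == k) then - B i j
    else B i j + ((`|B i k| * B k j + B i k * `|B k j|) %/ 2)%Z.

Definition exchange_poly (s : seed) (k : 'I_n) : F :=
  \prod_j cluster s j ^ Num.max (exchange s k j) 0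
    + \prod_j cluster s j ^ (- Num.min (exchange s k j) 0).

Definition mutate (s : seed) (k : 'I_n) : seed :=
  Seed (fun j => if j == k then (cluster s k)^-1 * exchange_poly s k
                 else cluster s j)
       (mutate_mx k (exchange s)).

Definition mutations (s : seed) (ks : seq 'I_n) : seed := foldl mutate s ks.

(* The K-subalgebra of K(x_1, .., x_n) generated by all cluster variables;
   closure under opposite comes from multiplication by the constant -1. *)
Inductive cluster_algebra (s : seed) : F -> Prop :=
| ca_cst c : cluster_algebra s (ratcst c)
| ca_var ks i : cluster_algebra s (cluster (mutations s ks) i)
| ca_add f g : cluster_algebra s f -> cluster_algebra s g ->
    cluster_algebra s (f + g)
| ca_mul f g : cluster_algebra s f -> cluster_algebra s g ->
    cluster_algebra s (f * g).

(* The quiver with an arrow i -> j when b_ij > 0 has no oriented cycle. *)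
Definition acyclic_mx (B : 'M[int]_n) : Prop :=
  forall c : seq 'I_n, c != [::] -> ~~ cycle (fun i j => 0 < B i j) c.

Definition acyclic_cluster_algebra (s : seed) : Prop :=
  exists ks, acyclic_mx (exchange (mutations s ks)).

End Seeds.

Definition mxQ n (B : 'M[int]_n) : 'M[rat]_n := map_mx intr B.

Definition compatible_pair n (B Lam : 'M[int]_n) : Prop :=
  is_diag_mx (B *m Lam) /\ forall i, 0 < (B *m Lam) i i.

Section Bracket.
Variables (K : fieldType) (n : nat).
Local Notation F := (ratfun K n).

(* Quotient rule on a representative; independent of it by [partialE]. *)
Definition partial (i : 'I_n) (f : F) : F :=
  let q := repr f in
  tofrac ((\n_q)^`M(i) * \d_q - \n_q * (\d_q)^`M(i)) / tofrac (\d_q) ^+ 2.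

(* This is the Poisson bracket determined by {x_i, x_j} = lam_ij x_i x_j: see
   [log_bracket_poisson] and [log_bracket_var]. *)
Definition log_bracket (Lam : 'M[int]_n) (f g : F) : F :=
  \sum_i \sum_j (Lam i j)%:~R * (ratvar K i * partial i f)
                              * (ratvar K j * partial j g).

Definition poisson_bracket (br : F -> F -> F) : Prop :=
  [/\ forall c f g h, br (ratcst n c * f + g) h = ratcst n c * br f h + br g h,
      forall f g, br f g = - br g f,
      forall f g h, br f (g * h) = br f g * h + g * br f h
    & forall f g h, br f (br g h) + br g (br h f) + br h (br f g) = 0].

Definition derivation (D : F -> F) : Prop :=
  {morph D : f g / f + g} /\ forall f g, D (f * g) = D f * g + f * D g.

Lemma frac_repr (f : F) : f = tofrac \n_(repr f) / tofrac \d_(repr f).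
Proof.
set d := \d_(repr f).
have d0 : tofrac d != 0 by rewrite tofrac_eq0 denom_ratioP.
apply: (mulIf d0); rewrite divfK // /d {d d0}.
rewrite -{1}[f]reprK; move: (repr f) => q.
rewrite -[LHS]/(FracField.mul _ _) !piE.
apply/eqmodP; rewrite /= FracField.equivfE /FracField.mulf /=.
by rewrite !numden_Ratio ?mulf_neq0 ?oner_neq0 ?denom_ratioP // !mulr1 mulrC.
Qed.

Lemma partialE i (a b : {mpoly K[n]}) : b != 0 ->
  partial i (tofrac a / tofrac b)
  = tofrac (a^`M(i) * b - a * b^`M(i)) / tofrac b ^+ 2.
Proof.
move=> b0; set f := tofrac a / tofrac b; rewrite /partial.
have d0 : \d_(repr f) != 0 by exact: denom_ratioP.
have := frac_repr f; rewrite {1}/f.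
move: (\n_(repr f)) (\d_(repr f)) d0 => p q q0 /eqP.
rewrite eqr_div ?tofrac_eq0 // -!tofracM tofrac_eq => /eqP e.
have /= de := congr1 (mderiv i) e; rewrite !mderivM in de.
apply/eqP; rewrite eqr_div ?expf_neq0 ?tofrac_eq0 // -!tofracXn -!tofracM.
rewrite tofrac_eq; apply/eqP.
apply: subr0_eq.
transitivity (q * b * (p^`M(i) * b + p * b^`M(i) - (a^`M(i) * q + a * q^`M(i)))
              + (a * q - p * b) * (b * q^`M(i) + q * b^`M(i))); first by ring.
by rewrite de e !subrr mulr0 mul0r addr0.
Qed.

Lemma fracP (f : F) : exists a b, b != 0 /\ f = tofrac a / tofrac b.
Proof.
exists \n_(repr f), \d_(repr f); split; [exact: denom_ratioP|exact: frac_repr].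
Qed.

Lemma partial_poly i (a : {mpoly K[n]}) :
  partial i (tofrac a) = tofrac a^`M(i).
Proof.
have := partialE i a (oner_neq0 _).
by rewrite tofrac1 divr1 expr1n divr1 -mpolyC1 mderivC mpolyC1 mulr1 mulr0 subr0.
Qed.

Fact quotient_ruleD (E : fieldType) (a b c d a' b' c' d' : E) :
  b != 0 -> d != 0 ->
  ((a' * d + a * d' + (c' * b + c * b')) * (b * d)
     - (a * d + c * b) * (b' * d + b * d')) / (b * d) ^+ 2
  = (a' * b - a * b') / b ^+ 2 + (c' * d - c * d') / d ^+ 2.
Proof. by move=> b0 d0; field; rewrite b0 d0. Qed.

Fact quotient_ruleM (E : fieldType) (a b c d a' b' c' d' : E) :
  b != 0 -> d != 0 ->
  ((a' * c + a * c') * (b * d) - (a * c) * (b' * d + b * d')) / (b * d) ^+ 2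
  = (a' * b - a * b') / b ^+ 2 * (c / d)
    + a / b * ((c' * d - c * d') / d ^+ 2).
Proof. by move=> b0 d0; field; rewrite b0 d0. Qed.

Lemma partial_derivation i : derivation (partial i).
Proof.
split=> f g; have [a [b [b0 ->]]] := fracP f; have [c [d [d0 ->]]] := fracP g.
  rewrite addf_div ?tofrac_eq0 // -!tofracM -tofracD !partialE ?mulf_neq0 //.
  rewrite !(mderivM, mderivD) !(tofracM, tofracB, tofracD).
  by rewrite quotient_ruleD ?tofrac_eq0.
rewrite mulf_div -!tofracM !partialE ?mulf_neq0 //.
rewrite !(mderivM, mderivD) !(tofracM, tofracB, tofracD).
by rewrite quotient_ruleM ?tofrac_eq0.
Qed.

Lemma derivation_eq0 (D : F -> F) : derivation D ->
  (forall a, D (tofrac a) = 0) -> forall f, D f = 0.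
Proof.
move=> [_ DM] D0 f; have [a [b [b0 ->]]] := fracP f.
have b0' : tofrac b != 0 by rewrite tofrac_eq0.
have := DM (tofrac a / tofrac b) (tofrac b).
by rewrite divfK // !D0 mulr0 addr0 => /esym/eqP; rewrite mulf_eq0 (negPf b0')
  orbF => /eqP.
Qed.

Definition lpartial i (f : F) : F := ratvar K i * partial i f.

Lemma lpartial_derivation i : derivation (lpartial i).
Proof.
have [dD dM] := partial_derivation i.
by split=> f g; rewrite /lpartial ?dD ?dM; ring.
Qed.

Lemma lpartial_sum i I (r : seq I) (P : pred I) (E : I -> F) :
  lpartial i (\sum_(j <- r | P j) E j) = \sum_(j <- r | P j) lpartial i (E j).
Proof.
have [dD _] := lpartial_derivation i.
apply: (big_morph _ dD).
by apply: (addrI (lpartial i 0)); rewrite -dD !addr0.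
Qed.

Lemma lpartial_poly i a : lpartial i (tofrac a) = tofrac ('X_i * a^`M(i)).
Proof. by rewrite /lpartial partial_poly tofracM. Qed.

Lemma lpartial_cst i c : lpartial i (ratcst n c) = 0.
Proof. by rewrite lpartial_poly mderivC mulr0 tofrac0. Qed.

Lemma mderiv_var i j : ('X_j : {mpoly K[n]})^`M(i) = (j == i)%:R.
Proof.
rewrite mderivX mnm1E; case: eqP => [->|_]; last by rewrite scale0r.
have -> : (U_(i) - U_(i) = 0)%MM by apply/mnmP => a; rewrite mnmBE subnn mnm0E.
by rewrite scale1r mpolyX0.
Qed.

Lemma lpartial_var i j : lpartial i (ratvar K j) = (j == i)%:R * ratvar K j.
Proof.
rewrite /ratvar lpartial_poly mderiv_var.
by case: eqP => [->|_]; rewrite ?mulr1 ?mul1r // mulr0 mul0r tofrac0.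
Qed.

Fact commutator_rule (A : comPzRingType) (g gi gj gij gji h hi hj hij hji : A) :
  gij * h + gj * hi + (gi * hj + g * hij)
    - (gji * h + gi * hj + (gj * hi + g * hji))
  = (gij - gji) * h + g * (hij - hji).
Proof. ring. Qed.

Lemma lpartialC i j f : lpartial i (lpartial j f) = lpartial j (lpartial i f).
Proof.
apply: subr0_eq.
have [iD iM] := lpartial_derivation i; have [jD jM] := lpartial_derivation j.
pose E f := lpartial i (lpartial j f) - lpartial j (lpartial i f).
apply: (@derivation_eq0 E) => [|a].
  split=> g h; rewrite /E; first by rewrite iD jD iD jD opprD addrACA.
  by rewrite iM jM !iD !jD !iM !jM commutator_rule.
apply/eqP; rewrite /E !lpartial_poly -tofracB tofrac_eq0 !mderivM !mderiv_var.
rewrite mderiv_comm; have [->|ij] := eqVneq i j; first by rewrite subrr.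
by rewrite !mul0r !add0r mulrCA subrr.
Qed.

Lemma lpartial_int i (z : int) f :
  lpartial i (z%:~R * f) = z%:~R * lpartial i f.
Proof.
have [_ dM] := lpartial_derivation i.
have -> : z%:~R = ratcst n z%:~R :> F by rewrite /ratcst !rmorph_int.
by rewrite dM lpartial_cst mul0r add0r.
Qed.

Lemma log_bracketE (Lam : 'M[int]_n) f g : log_bracket Lam f g =
  \sum_i \sum_j (Lam i j)%:~R * lpartial i f * lpartial j g.
Proof. by []. Qed.

Lemma log_bracket_var (Lam : 'M[int]_n) i j :
  log_bracket Lam (ratvar K i) (ratvar K j)
  = (Lam i j)%:~R * ratvar K i * ratvar K j.
Proof.
rewrite log_bracketE (bigD1 i) //= [X in _ + X]big1 ?addr0 => [|a ai].
  rewrite (bigD1 j) //= big1 ?addr0 => [|b bj].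
    by rewrite !lpartial_var !eqxx !mul1r.
  by rewrite [lpartial b _]lpartial_var eq_sym (negPf bj) mul0r mulr0.
apply: big1 => b _.
by rewrite [lpartial a _]lpartial_var eq_sym (negPf ai) mul0r mulr0 mul0r.
Qed.

Lemma log_bracket_poisson (Lam : 'M[int]_n) :
  Lam^T = - Lam -> poisson_bracket (log_bracket Lam).
Proof.
move=> sk; have skE a b : Lam a b = - Lam b a.
  by have /matrixP/(_ b a) := sk; rewrite !mxE.
have lD i : {morph lpartial i : f g / f + g} by case: (lpartial_derivation i).
have lM i f g : lpartial i (f * g) = lpartial i f * g + f * lpartial i g.
  by case: (lpartial_derivation i).
have brN f g : log_bracket Lam f g = - log_bracket Lam g f.
  rewrite !log_bracketE exchange_big /= -sumrN; apply: eq_bigr => a _.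
  rewrite -sumrN; apply: eq_bigr => b _.
  by rewrite (skE b a) rmorphN /=; ring.
pose T f g h := \sum_a \sum_b \sum_c \sum_d (Lam a b)%:~R * (Lam c d)%:~R
  * (lpartial a f * lpartial b (lpartial c g) * lpartial d h) : F.
have TE f g h : log_bracket Lam f (log_bracket Lam g h) = T f g h - T f h g.
  rewrite log_bracketE /T -sumrB; apply: eq_bigr => a _.
  rewrite -sumrB; apply: eq_bigr => b _.
  rewrite log_bracketE lpartial_sum mulr_sumr.
  rewrite [X in _ - X]exchange_big /= -sumrB; apply: eq_bigr => c _.
  rewrite lpartial_sum mulr_sumr -sumrB; apply: eq_bigr => d _.
  rewrite [lpartial b (_ * lpartial d h)]lM lpartial_int (skE d c) rmorphN /=; ring.
have Tsym f g h : T f g h = T h g f.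
  rewrite /T exchange_big /=.
  rewrite (eq_bigr (fun b => \sum_c \sum_d \sum_a (Lam a b)%:~R * (Lam c d)%:~R
   * (lpartial a f * lpartial b (lpartial c g) * lpartial d h))); last first.
    by move=> b _; rewrite exchange_big; apply: eq_bigr => c _; rewrite exchange_big.
  rewrite exchange_big /= (eq_bigr (fun c => \sum_d \sum_b \sum_a
    (Lam a b)%:~R * (Lam c d)%:~R
   * (lpartial a f * lpartial b (lpartial c g) * lpartial d h))); last first.
    by move=> c _; rewrite exchange_big.
  rewrite exchange_big /=; do 4 (apply: eq_bigr => ? _).
  rewrite lpartialC [in LHS]skE [X in _ * X%:~R * _ = _]skE !rmorphN /=; ring.
split=> // [c f g h|f g h|f g h].
- rewrite !log_bracketE mulr_sumr -big_split; apply: eq_bigr => a _ /=.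
  rewrite mulr_sumr -big_split; apply: eq_bigr => b _ /=.
  by rewrite lD lM lpartial_cst; ring.
- rewrite !log_bracketE mulr_suml mulr_sumr -big_split; apply: eq_bigr => a _ /=.
  rewrite mulr_suml mulr_sumr -big_split; apply: eq_bigr => b _ /=.
  by rewrite lM; ring.
- by rewrite !TE (Tsym h f g) (Tsym h g f) (Tsym f h g); ring.
Qed.

End Bracket.

Section PoissonIdeals.
Variables (K : fieldType) (n : nat).
Local Notation F := (ratfun K n).

Definition prime_ideal (A I : F -> Prop) : Prop :=
  [/\ forall f, I f -> A f,
      I 0 /\ (forall f g, I f -> I g -> I (f + g)),
      forall a f, A a -> I f -> I (a * f),
      ~ I 1
    & forall f g, A f -> A g -> I (f * g) -> I f \/ I g].

Definition poisson_prime_ideal (A : F -> Prop) (br : F -> F -> F)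
    (I : F -> Prop) : Prop :=
  prime_ideal A I /\ forall h a, I h -> A a -> I (br h a).

End PoissonIdeals.

(* Main.v *)
Require Import Defs.
From mathcomp Require Import all_boot all_order all_algebra.
From mathcomp Require Import fraction complex reals mpoly ring zify.
Import Order.TTheory GRing.Theory Num.Theory.
Local Open Scope ring_scope.

(** Let I be a Poisson prime ideal. The bracket with x_j acts on a polynomial
    as x_j times a derivation H_j that scales every monomial x^m by
    (Lam m)_j ([log_bracket_ratvar], [hamiltonian_mpolyX]).

    If I contains no x_j, primality makes the polynomials of I stable under
    all H_j, and since B Lam = mu they are then stable under every Euler
    operator x_i d/dx_i ([lpartial_hamiltonian]). Joint eigenvalues of these
    operators separate monomials in characteristic 0, so a nonzero polynomial
    of I would put a monomial in I ([euler_closed_mpolyX]), and primality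
    would put some x_i in I. As I meets the polynomials as soon as it is
    nonzero (clear denominators), I = 0 ([poisson_prime_eq0]).

    If I contains x_i, it contains x_i y_i = P+ + P-, the sum of the two
    exchange monomials, and also {x_i, y_i}, which is a combination
    alpha P+ + beta P- up to multiples of x_i y_i. Here alpha - beta is the
    i-th diagonal entry of - B Lam, so it is nonzero and P- lies in I
    ([ideal_neg_part]). As b_ij > 0 for i < j, P- only involves variables x_j
    with j < i, one of which lies in I by primality. Descent on i shows that
    I contains no x_i at all, hence that I = 0. *)

Set Implicit Arguments.
Unset Strict Implicit.
Unset Printing Implicit Defensive.

(** * Euler operators on polynomials *)

Section Euler.
Variables (K : fieldType) (n : nat).

Lemma euler_mpolyX i (m : 'X_{1..n}) :
  'X_i * 'X_[K, m]^`M(i) = (m i)%:R *: 'X_[m].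
Proof.
rewrite mderivX -scalerAr -mpolyXD; have [->|mi0] := eqVneq (m i) 0%N.
  by rewrite !scale0r.
by rewrite addmC submK // lep1mP.
Qed.

Lemma mcoeff_euler i (p : {mpoly K[n]}) m :
  ('X_i * p^`M(i))@_m = (m i)%:R * p@_m.
Proof.
rewrite {1}[p]mpolyE linear_sum /= mulr_sumr raddf_sum /=.
rewrite [in RHS](mpolyE p) raddf_sum mulr_sumr; apply: eq_bigr => m' _ /=.
rewrite mderivZ -scalerAr euler_mpolyX !mcoeffZ mcoeffX.
by case: eqP => [->|_]; rewrite ?mulr0 // !mulr1 mulrC.
Qed.

(** If x^m and x^m' occur in p and m_i <> m'_i, then x_i d/dx_i p - m_i p lies
    in J, is nonzero, and has smaller support; so a nonzero element of minimal
    support is a multiple of a monomial. *)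
Lemma euler_closed_mpolyX (J : {mpoly K[n]} -> Prop) p :
    [pchar K] =i pred0 ->
    (forall c q r, J q -> J r -> J (c *: q + r)) ->
    (forall i q, J q -> J ('X_i * q^`M(i))) ->
  J p -> p != 0 -> exists m, J 'X_[m].
Proof.
move=> /pcharf0P char0 Jlin Jeuler.
have J0 q : J q -> J 0 by move=> Jq; rewrite -(subrr q) addrC -scaleN1r; exact: Jlin.
elim: {p}_.+1 {-2}p (ltnSn (size (msupp p))) => // N IH p + Jp p0.
rewrite ltnS; case supp_p: (msupp p) => [|m [|m' s]] sizeN.
- by case/eqP: p0; apply/eqP; rewrite -msupp_eq0 supp_p.
- exists m; have pm0 : p@_m != 0 by rewrite -mcoeff_msupp supp_p mem_head.
  rewrite -['X_[m]](scalerK pm0) -[_ *: _]addr0; apply: (Jlin); last exact: J0 Jp.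
  by move: Jp; rewrite {1}[p]mpolyE supp_p big_seq1.
have [uniq_m uniq_s] : m \notin m' :: s /\ uniq (m' :: s).
  by have := msupp_uniq p; rewrite supp_p => /andP[].
(* The coordinate i tells apart two monomials of p; q kills the first one and
   keeps the second. *)
have [i mi] : exists i, m i != m' i.
  apply/existsP; move: uniq_m; apply: contraNT => /existsPn eqm.
  rewrite inE; apply/orP; left; apply/eqP/mnmP => i; apply/eqP.
  by have := eqm i; rewrite negbK.
pose q := - (m i)%:R *: p + 'X_i * p^`M(i).
have coef_q l : q@_l = ((l i)%:R - (m i)%:R) * p@_l.
  by rewrite mcoeffD mcoeffZ mcoeff_euler; ring.
apply: (IH q).
- apply: leq_trans sizeN; apply: (@uniq_leq_size _ _ (m' :: s)) => [|l].
    exact: msupp_uniq.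
  rewrite mcoeff_msupp coef_q mulf_eq0 negb_or subr_eq0 => /andP[li].
  rewrite -mcoeff_msupp supp_p inE => /orP[/eqP lm|//].
  by rewrite lm eqxx in li.
- by apply: Jlin => //; apply: Jeuler.
apply: contraNneq mi => q0; have /eqP := coef_q m'.
rewrite q0 mcoeff0 eq_sym mulf_eq0 [p@_m' == 0]negbTE ?orbF; last first.
  by rewrite -mcoeff_msupp supp_p !inE eqxx orbT.
case: (leqP (m i) (m' i)) => [le|/ltnW le].
  rewrite -natrB // char0 subn_eq0 => ge.
  by rewrite eqn_leq le ge.
by rewrite -opprB oppr_eq0 -natrB // char0 subn_eq0 => ge; rewrite eqn_leq ge le.
Qed.

End Euler.

(** * Poisson prime ideals of the cluster algebra *)

Section Ideal.
Variables (K : fieldType) (n : nat).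
Local Notation F := (ratfun K n).
Variables (B Lam : 'M[int]_n) (d : int).
Local Notation A := (cluster_algebra (initial_seed K B)).
Local Notation P_in p := (tofrac (p : {mpoly K[n]})).

Lemma cluster_algebra_mpoly p : A (P_in p).
Proof.
have A0 : A 0 by have := ca_cst (initial_seed K B) 0; rewrite /ratcst mpolyC0 tofrac0.
have A1 : A 1 by have := ca_cst (initial_seed K B) 1; rewrite /ratcst mpolyC1 tofrac1.
rewrite [p]mpolyE rmorph_sum /=; apply: (big_ind A) => //; first exact: ca_add.
move=> m _; rewrite -mul_mpolyC rmorphM /=; apply: ca_mul; first exact: ca_cst.
rewrite mpolyXE_id rmorph_prod /=; apply: (big_ind A) => //; first exact: ca_mul.
move=> i _; rewrite rmorphXn /=; elim: (m i) => [|e IH]; first by rewrite expr0.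
by rewrite exprS; apply: ca_mul => //; exact: (ca_var (initial_seed K B) [::]).
Qed.

Variable I : F -> Prop.

Lemma prime_ideal_mpolyX (m : 'X_{1..n}) :
  prime_ideal A I -> I (P_in 'X_[m]) -> exists2 i, (0 < m i)%N & I (ratvar K i).
Proof.
case=> _ _ _ I1 Iprime.
elim: {m}_.+1 {-2}m (ltnSn (mdeg m)) => // N IH m.
rewrite ltnS => degm Im.
have [/eqP m0|[i mi]] : mdeg m == 0%N \/ exists i, (0 < m i)%N.
- have [?|m0] := boolP (mdeg m == 0%N); [by left|right].
  apply/existsP; move: m0; apply: contraNT => /existsPn m0.
  rewrite mdegE; apply/eqP; rewrite big1 // => i _; apply/eqP.
  by have := m0 i; rewrite -eqn0Ngt.
- by case: I1; move/eqP: m0; rewrite mdeg_eq0 => /eqP m0; rewrite m0 mpolyX0 tofrac1 in Im.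
have Em : m = (U_(i) + (m - U_(i)))%MM by rewrite addmC submK // lep1mP -lt0n.
move: Im; rewrite Em mpolyXD tofracM => Im.
have [] := Iprime _ _ (cluster_algebra_mpoly _) (cluster_algebra_mpoly _) Im.
  by move=> Ii; exists i => //; rewrite -Em.
move=> /IH[|j mj Ij]; last by exists j => //; rewrite -Em; move: mj; rewrite mnmBE; lia.
by move: degm; rewrite {1}Em mdegD mdeg1.
Qed.

Definition hamiltonian (j : 'I_n) (f : F) : F :=
  \sum_k (Lam j k)%:~R * lpartial k f.

(** Dividing the bracket with x_j by x_j gives a derivation for which all
    monomials are eigenvectors. *)
Lemma log_bracket_ratvar j f :
  log_bracket Lam (ratvar K j) f = ratvar K j * hamiltonian j f.
Proof.
rewrite log_bracketE (bigD1 j) //= [X in _ + X]big1 ?addr0 => [|a aj]; last first.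
  apply: big1 => b _.
  by rewrite [lpartial a _]lpartial_var eq_sym (negPf aj) mul0r mulr0 mul0r.
rewrite mulr_sumr; apply: eq_bigr => k _.
by rewrite [lpartial j _]lpartial_var eqxx mul1r mulrAC [LHS]mulrC.
Qed.

Lemma hamiltonian_mpoly j p : hamiltonian j (P_in p) =
  P_in (\sum_k (Lam j k)%:~R * ('X_k * p^`M(k))).
Proof.
rewrite rmorph_sum; apply: eq_bigr => k _ /=.
by rewrite lpartial_poly [in RHS]rmorphM /= rmorph_int.
Qed.

Lemma hamiltonian_mpolyX j (m : 'X_{1..n}) : hamiltonian j (P_in 'X_[m]) =
  (\sum_k Lam j k * (m k)%:Z)%:~R * P_in 'X_[m].
Proof.
rewrite [RHS]mulrC rmorph_sum /= mulr_sumr; apply: eq_bigr => k _.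
rewrite lpartial_poly euler_mpolyX -mul_mpolyC rmorphM /= rmorph_nat rmorphM /=.
by rewrite rmorph_nat [RHS]mulrC -mulrA.
Qed.

Lemma hamiltonianD j f g : hamiltonian j (f + g) = hamiltonian j f + hamiltonian j g.
Proof.
rewrite -big_split; apply: eq_bigr => k _ /=.
by have [-> _] := lpartial_derivation K k; rewrite mulrDr.
Qed.

Lemma hamiltonianM j f g :
  hamiltonian j (f * g) = hamiltonian j f * g + f * hamiltonian j g.
Proof.
rewrite mulr_suml mulr_sumr -big_split; apply: eq_bigr => k _ /=.
by have [_ ->] := lpartial_derivation K k; rewrite mulrDr !mulrA [f * _]mulrC.
Qed.

(** The Hamiltonian derivations are the rows of Lam applied to the Euler
    operators, so inverting Lam recovers the Euler operators. *)
Lemma lpartial_hamiltonian i f : B *m Lam = d%:M ->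
  d%:~R * lpartial i f = \sum_j (B i j)%:~R * hamiltonian j f.
Proof.
move=> BLam; under eq_bigr do rewrite mulr_sumr.
rewrite exchange_big (bigD1 i) //= [X in _ + X]big1 ?addr0 => [|k ki].
  under eq_bigr do rewrite mulrA -intrM.
  rewrite -mulr_suml -rmorph_sum /=; congr (_%:~R * _).
  by have /matrixP/(_ i i) := BLam; rewrite !mxE eqxx mulr1n.
under eq_bigr do rewrite mulrA -intrM.
rewrite -mulr_suml -rmorph_sum /=.
have /matrixP/(_ i k) := BLam; rewrite !mxE eq_sym (negPf ki) mulr0n => ->.
by rewrite mul0r.
Qed.

Hypothesis skew_Lam : Lam^T = - Lam.
Hypothesis BLam : B *m Lam = d%:M.
Hypothesis d_neq0 : d%:~R != 0 :> K.
Hypothesis I_poisson : poisson_prime_ideal A (log_bracket Lam) I.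

Lemma ideal_cstM c f : I f -> I (ratcst n c * f).
Proof. by case: I_poisson => -[_ _ IM _ _] _; apply: IM; exact: ca_cst. Qed.

Lemma ratcst_int z : ratcst n (z%:~R : K) = z%:~R.
Proof. by rewrite /ratcst !rmorph_int. Qed.

Lemma ideal_intM z f : I f -> I (z%:~R * f).
Proof. by rewrite -ratcst_int; exact: ideal_cstM. Qed.

Lemma ideal_int_cancel z f : z%:~R != 0 :> K -> I (z%:~R * f) -> I f.
Proof.
move=> z0 /(ideal_cstM z%:~R^-1); rewrite -ratcst_int mulrA /ratcst.
by rewrite -!rmorphM /= mulVf // !rmorph1 mul1r.
Qed.

Lemma ideal_bracket_ratvar j f : I f -> I (ratvar K j * hamiltonian j f).
Proof.
have [_ brN _ _] := log_bracket_poisson K skew_Lam.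
move=> If; rewrite -log_bracket_ratvar brN -mulN1r -(mulrN1z 1).
apply: ideal_intM; apply: I_poisson.2 => //.
exact: (ca_var (initial_seed K B) [::]).
Qed.

(** A nonzero element of the ideal has a nonzero numerator, again in the ideal.
    The polynomials of the ideal being closed under the Euler operators, one of
    them is a monomial, and by primality the ideal contains a variable. *)
Lemma poisson_prime_eq0 h : [pchar K] =i pred0 ->
  (forall i, ~ I (ratvar K i)) -> I h -> h = 0.
Proof.
move=> char0 Ivar Ih; have Iprime := I_poisson.1.
have [_ [I0 ID] IM _ Ior] := Iprime.
have [a [b [b0 hE]]] := fracP h; have Ia : I (P_in a).
  have := IM _ _ (cluster_algebra_mpoly b) Ih.
  by rewrite hE mulrC divfK // tofrac_eq0.
have [a_eq0|a0] := eqVneq a 0; first by rewrite hE a_eq0 tofrac0 mul0r.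
case: (@euler_closed_mpolyX _ _ (fun p => I (P_in p)) a char0) => //.
- move=> c p q Ip Iq; rewrite -mul_mpolyC tofracD tofracM; apply: ID => //.
  exact: ideal_cstM.
- (* Each x_j H_j p is in I; cancel x_j by primality. *)
  move=> i p Ip; rewrite -lpartial_poly; apply: (ideal_int_cancel d_neq0).
  rewrite (lpartial_hamiltonian _ _ BLam); apply: (big_ind I) => // j _.
  apply: ideal_intM; have := ideal_bracket_ratvar j Ip.
  rewrite hamiltonian_mpoly => /Ior[||/Ivar|] //; exact: cluster_algebra_mpoly.
by move=> m /(prime_ideal_mpolyX Iprime)[i _ /Ivar].
Qed.

Definition pos_part i := [multinom `|Num.max (B i j) 0|%N | j < n].
Definition neg_part i := [multinom `|Num.min (B i j) 0|%N | j < n].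

Lemma exchange_poly_initial i : exchange_poly (initial_seed K B) i =
  P_in 'X_[pos_part i] + P_in 'X_[neg_part i].
Proof.
rewrite /exchange_poly !mpolyXE_id !rmorph_prod /=.
congr (_ + _); apply: eq_bigr => j _; rewrite mnmE rmorphXn /= -/(ratvar K j).
  by rewrite exprnP gez0_abs // le_max lexx orbT.
by rewrite exprnP abszE ler0_norm // ge_min lexx orbT.
Qed.

(** Both x_i y_i and the derivation H_i of x_i y_i lie in the ideal. They are
    combinations of the two exchange monomials with coefficients (1, 1) and
    (a, b) where a - b = - d is nonzero, so they can be solved for the second
    monomial. *)
Lemma ideal_neg_part i : I (ratvar K i) -> I (P_in 'X_[neg_part i]).
Proof.
have [[_ [_ ID] IM _ _] Ibr] := I_poisson.
move=> Ii; pose y := cluster (mutations (initial_seed K B) [:: i]) i.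
have Ay : A y by exact: ca_var.
have xyE : ratvar K i * y = P_in 'X_[pos_part i] + P_in 'X_[neg_part i].
  rewrite -exchange_poly_initial /y /= eqxx mulVKf //= tofrac_eq0.
  by rewrite -msize_poly_eq0 msizeX.
have Ixy : I (ratvar K i * y) by rewrite mulrC; apply: IM.
have Iham : I (hamiltonian i (ratvar K i * y)).
  rewrite hamiltonianM; apply: ID; last by rewrite -log_bracket_ratvar; exact: Ibr.
  by rewrite hamiltonian_mpolyX -mulrA; exact: ideal_intM.
move: Ixy Iham; rewrite xyE hamiltonianD !hamiltonian_mpolyX.
set a := \sum_k _; set b := \sum_k _ => Ixy Iham.
(* The exponents of the two monomials differ by row i of B. *)
have ab : a = b - d.
  apply/eqP; rewrite -subr_eq0 opprB addrCA addrC -sumrB.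
  have : (B *m Lam) i i = d by rewrite BLam mxE eqxx.
  rewrite mxE => {1}<-; rewrite -big_split big1 //= => k _.
  rewrite !mnmE; have /matrixP/(_ k i) := skew_Lam; rewrite !mxE => ->.
  rewrite -mulrBr (_ : _ - _ = B i k) ?mulNr 1?mulrC ?addNr //.
  by rewrite gez0_abs ?le_max ?lexx ?orbT // abszE ler0_norm ?ge_min ?lexx ?orbT //
    opprK addr_max_min addr0.
apply: (@ideal_int_cancel d) => //.
have := ID _ _ Iham (ideal_intM (- a) Ixy).
by congr I; rewrite ab; ring.
Qed.

End Ideal.

Theorem theorem4p1 (R : realType) (n k : nat) (n_even : n = (2 * k)%N)
  (B Lam : 'M[int]_n) (mu : int)
  (B_acyclic : acyclic_cluster_algebra (initial_seed R[i] B))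
  (B_inv : mxQ B \in unitmx)
  (B_skew : B^T = - B)
  (B_pos : forall i j : 'I_n, (i < j)%N -> 0 < B i j)
  (B_sum : forall i : 'I_n,
     \sum_j invmx (mxQ B) i j * (Num.max (B i j) 0 + Num.min (B i j) 0)%:~R != 0)
  (mu_neq0 : mu != 0)
  (LamE : mxQ Lam = mu%:~R *: invmx (mxQ B))
  (BLam : compatible_pair B Lam) :
  ~ exists I : ratfun R[i] n -> Prop,
      poisson_prime_ideal (cluster_algebra (initial_seed R[i] B))
                          (log_bracket Lam) I
      /\ exists h, I h /\ h <> 0.
Proof.
have mxQ_inj : injective (@mxQ n).
  move=> M N /matrixP eqMN; apply/matrixP => i j.
  by have := eqMN i j; rewrite !mxE => /intr_inj.
have BLam_mu : B *m Lam = mu%:M.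
  apply: mxQ_inj; rewrite /mxQ map_mxM -!/(mxQ _) LamE.
  by rewrite -scalemxAr mulmxV // /mxQ map_scalar_mx /= scalemx1.
have LamB_mu : Lam *m B = mu%:M.
  apply: mxQ_inj; rewrite /mxQ map_mxM -!/(mxQ _) LamE.
  by rewrite -scalemxAl mulVmx // /mxQ map_scalar_mx /= scalemx1.
have Lam_skew : Lam^T = - Lam.
  have eqB : Lam^T *m B = - Lam *m B.
    rewrite mulNmx LamB_mu -[B]opprK -B_skew mulmxN -trmx_mul BLam_mu.
    by rewrite tr_scalar_mx.
  apply: mxQ_inj.
  have := congr1 (fun M => mxQ M *m invmx (mxQ B)) eqB.
  by rewrite /mxQ !map_mxM /= -!/(mxQ B) !mulmxK.
have mu0 : mu%:~R != 0 :> R[i] by rewrite intr_eq0.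
case=> I [I_poisson [h [Ih h0]]]; apply: h0.
apply: (poisson_prime_eq0 Lam_skew BLam_mu mu0 I_poisson (@pchar_num _)) Ih.
(* Descent on the index of a variable lying in the ideal. *)
case=> i; elim/ltn_ind: i => i IH lt_i Ii.
have Im := ideal_neg_part Lam_skew BLam_mu mu0 I_poisson Ii.
have [[j lt_j] mj Ij] := prime_ideal_mpolyX I_poisson.1 Im.
apply: (IH j _ lt_j Ij); rewrite ltnNge; apply: contraTN mj; rewrite leq_eqVlt mnmE.
case/predU1P => [ij|/(B_pos (Ordinal lt_i) (Ordinal lt_j)) Bij]; last first.
  by rewrite min_r // ltW.
have -> : Ordinal lt_j = Ordinal lt_i by apply: val_inj.
have /matrixP/(_ (Ordinal lt_i) (Ordinal lt_i)) := B_skew; rewrite !mxE.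
by move: (B _ _) => b /eqP; rewrite -addr_eq0 => b0; have -> : b = 0 by lia.
Qed.
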